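(* Let $(\alpha,\beta)$ be a pair of real-valued random variables with $\mathbb{P}(\alpha=0)>0$. Then any bounded function $y:\mathbb{R}\to\mathbb{R}$ satisfying $$y(x)=\mathbb{E}\{y(\alpha(x-\beta))\}\qquad\text{for all }x\in\mathbb{R}$$ is constant on $\mathbb{R}$.
   Context: $\mathbb{E}$ denotes expectation with respect to the joint distribution of $(\alpha,\beta)$, an arbitrary probability measure on $\mathbb{R}^2$ subject to the stated hypothesis. The function $y$ is assumed Borel measurable so that the expectation makes sense; continuity of $y$ is not assumed. *)

(* Defs.v *)
From HB Require Import structures.
From mathcomp Require Export all_boot all_order all_algebra.
From mathcomp Require Export all_classical all_reals all_analysis.
Export Order.TTheory GRing.Theory Num.Theory.
Export numFieldNormedType.Exports.

(* Main.v *)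
Require Import Defs.
From mathcomp Require Import measurable_realfun.
Local Open Scope classical_set_scope.
Local Open Scope ring_scope.

(** On the event [alpha = 0] the variable [y (alpha * (x - beta))] does not
    depend on [x].  Hence averaging contracts the oscillation [s] of [y] by the
    factor [1 - P (alpha = 0) < 1]; as [s] is finite, [s = 0]. *)

Lemma le_dist_expectation (R : realType) (d : measure_display)
    (Omega : measurableType d) (P : probability Omega R) (X Y : Omega -> R)
    (A : set Omega) (D : R) :
  measurable A ->
  P.-integrable setT (EFin \o X) -> P.-integrable setT (EFin \o Y) ->
  (forall w, A w -> X w = Y w) -> (forall w, `|X w - Y w| <= D) ->
  (`| 'E_P[X] - 'E_P[Y] | <= D%:E * (1 - P A))%E.
Proof.
move=> mA iX iY XY XYD; rewrite unlock -integralB_EFin//.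
have mXY : measurable_fun setT (EFin \o (X \- Y)).
  by apply/measurable_EFinP/measurable_funB;
     apply/measurable_EFinP/(measurable_int P).
have iA : P.-integrable setT (fun w => (\1_(~` A) w)%:E).
  by apply: integrable_indic => //; exact: measurableC.
apply: (le_trans (le_abse_integral P measurableT mXY)).
rewrite -probability_setC// -[~` A]setIT -integral_indic//; last exact: measurableC.
rewrite -integralZl//; apply: ge0_le_integral => //.
- exact: measurableT_comp.
- apply: measurable_int; apply: integrableZl => //; exact: iA.
move=> w _ /=; rewrite -EFinM lee_fin indicE.
have [Aw|nAw] := pselect (A w).
  by rewrite (XY w Aw) subrr normr0 memNset ?mulr0//; exact.
by rewrite mem_set ?mulr1.
Qed.

Theorem theorem2p1 (R : realType) (d : measure_display) (Omega : measurableType d)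
    (P : probability Omega R) (alpha beta : {RV P >-> R})
    (halpha : (0 < P [set w | alpha w = 0%R])%E)
    (y : R -> R) (my : measurable_fun [set: R] y) (bndy : bounded_fun y)
    (hy : forall x : R,
        (y x)%:E = ('E_P[fun w => (y (alpha w * (x - beta w)))%R])%E) :
  exists c : R, forall x : R, y x = c.
Proof.
have [M /= yM] : exists M, forall x, `|y x| <= M.
  by have [M _ yM] := ex_strict_bound_gt0 bndy; exists M => x; exact/ltW/yM.
have mA : measurable [set w | alpha w = 0].
  exact: (measurable_funPTI alpha (measurable_set1 0)).
have yint x : P.-integrable setT (EFin \o fun w => y (alpha w * (x - beta w))).
  apply: measurable_bounded_integrable => //.
  - by apply: (le_lt_trans (probability_le1 P measurableT)); rewrite ltry.
  - apply: (measurableT_comp my); apply: measurable_funM => //.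
    by apply: measurable_funB.
  - exists M; split; first exact: num_real.
    by move=> K MK w _; exact: le_trans (yM _) (ltW MK).
pose S := [set r | exists x z, r = `|y x - y z|].
(* This is where boundedness of [y] makes [sup S] a true oscillation: on a set with no upper bound
   [sup] takes the default value 0. *)
have S_ub : has_ubound S.
  exists (M + M) => _ [x [z ->]]; apply: (le_trans (ler_normB _ _)).
  exact: lerD.
have yS x z : `|y x - y z| <= sup S by apply: ub_le_sup => //; exists x, z.
pose p := fine (P [set w | alpha w = 0]).
have pE : P [set w | alpha w = 0] = p%:E by rewrite fineK ?fin_num_measure.
have p0 : 0 < p by rewrite -lte_fin -pE.
have supS : sup S <= sup S * (1 - p).
  apply: ge_sup; first by exists `|y 0 - y 0|, 0, 0.
  move=> _ [x [z ->]].
  rewrite -lee_fin EFinM EFinB -pE -abse_EFin EFinB (hy x) (hy z).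
  (* Taken with [D := sup S], the pointwise bound being [yS]. Where [alpha w = 0], both variables
     equal [y 0], whatever [x] and [z] are. *)
  apply: le_dist_expectation => // w /= ->.
  by rewrite !mul0r.
have supS_le0 : sup S <= 0.
  (* Cancelling [sup S] leaves [sup S * p <= 0], and [p] is positive. *)
  by move: supS; rewrite mulrBr mulr1 lerBrDr gerDl pmulr_lle0.
exists (y 0) => x; apply/eqP; rewrite -subr_eq0 -normr_le0.
exact: le_trans supS_le0.
Qed.
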